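(* Let $1<a<b$ be relatively prime integers and let $m$ be a positive integer with $\ell(a,b,m)\leqslant 1$. Then the following hold. 1. The subspace $Q(a,b,m)\subset P(a,b,m)$ does not contain the origin of $\bar\lambda(a,b,m)$. 2. If $a$ divides $m$, then $Q(a,b,m)\cap\lambda'(a,b,m)=C_a'$. 3. If $b$ divides $m$, then $Q(a,b,m)\cap\lambda''(a,b,m)=C_b''$. 4. If neither $a$ nor $b$ divides $m$, then $\partial P(a,b,m)\subset Q(a,b,m)$.
   Context: For a positive integer $m$, $\ell(a,b,m)$ is the number of pairs $(i,j)$ of positive integers with $ai+bj=m$. Let $C_m\subset\mathbb{C}^*$ be the group of $m$th roots of unity and $\zeta_m=\exp(2\pi i/m)$. Choose integers $(c,d)$ with $ad-bc=1$. Let $J(a,b,m)$ be the set of integers in the closed interval $[cm/a,dm/b]$. Let $\mathbb{C}(n)$ be $\mathbb{C}$ with $z\in C_m$ acting by multiplication by $z^n$, and let $\bar\lambda(a,b,m)=\bigoplus_{n\in J(a,b,m)}\mathbb{C}(n)$. Let $x:\mathbb{R}[C_m]\to\bar\lambda(a,b,m)$ be the $\mathbb{R}$-linear map with $x(z)=(z^n)_{n\in J(a,b,m)}$ for $z\in C_m$. Let $\Delta^{m-1}\subset\mathbb{R}[C_m]$ be the convex hull of $C_m$; its simplices are the non-empty subsets $F\subset C_m$. The stunted regular cyclic polytope $P(a,b,m)\subset\bar\lambda(a,b,m)$ is the convex hull of $\{(z^n)_{n\in J(a,b,m)}\mid z\in C_m\}$, i.e. $P(a,b,m)=x(\Delta^{m-1})$;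 $\partial P(a,b,m)$ is its boundary. $\Sigma(a,b,m)\subset\Delta^{m-1}$ is the subcomplex whose simplices are the non-empty $F=\{\zeta_m^{r_1},\dots,\zeta_m^{r_h}\}$, $0\leqslant r_1<\dots<r_h<m$, such that all the gaps $r_{s+1}-r_s$ ($1\leqslant s<h$) and $r_1+m-r_h$ are of the form $ai+bj$ with $i,j$ non-negative integers. $Q(a,b,m)=x(\Sigma(a,b,m))\subset P(a,b,m)$. If $a$ divides $m$, then $\lambda'(a,b,m)\subset\bar\lambda(a,b,m)$ is the summand $\mathbb{C}(cm/a)$, and $C_a'\subset\lambda'(a,b,m)$ is the subset corresponding to the group $C_a\subset\mathbb{C}(cm/a)$ of $a$th roots of unity. If $b$ divides $m$, then $\lambda''(a,b,m)\subset\bar\lambda(a,b,m)$ is the summand $\mathbb{C}(dm/b)$, and $C_b''\subset\lambda''(a,b,m)$ is the subset corresponding to $C_b\subset\mathbb{C}(dm/b)$. *)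

(* Defs.v *)
From HB Require Import structures.
From mathcomp Require Import all_boot all_order all_algebra.
From mathcomp Require Import complex.
From mathcomp Require Import all_classical all_reals all_analysis.
From mathcomp Require Import ring lra.

Set Implicit Arguments.
Unset Strict Implicit.
Unset Printing Implicit Defensive.

Import Order.TTheory GRing.Theory Num.Theory.
Import numFieldNormedType.Exports.

Local Open Scope classical_set_scope.
Local Open Scope ring_scope.
Local Open Scope complex_scope.

(* R[i] seen as a numFieldType, so that matrices over it carry the topology
   of the analysis library. *)
Definition C (R : realType) : numFieldType := R[i].

(* For a, b > 0 the equation forces i, j <= m, so the bound loses no pair. *)
Definition ell (a b m : nat) : nat :=
  #|[pred p : 'I_m.+1 * 'I_m.+1 |
      [&& (0 < p.1)%N, (0 < p.2)%N & (a * p.1 + b * p.2 == m)%N]]|.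

Definition zeta (R : realType) (m : nat) : C R :=
  cos (2 * pi / m%:R) +i* sin (2 * pi / m%:R).

Lemma zeta_exp (R : realType) (m k : nat) :
  zeta R m ^+ k =
  (cos (2 * pi / m%:R *+ k) +i* sin (2 * pi / m%:R *+ k) : C R).
Proof.
elim: k => [|k IH]; first by rewrite !mulr0n cos0 sin0.
rewrite exprS IH [_ *+ k.+1]mulrS cosD sinD /zeta.
apply/eqP; rewrite eq_complex /=; apply/andP; split; apply/eqP => //.
by rewrite addrC.
Qed.

Lemma zeta_prim (R : realType) (m : nat) :
  (0 < m)%N -> m.-primitive_root (zeta R m).
Proof.
move=> m0; have m0R : (0 : R) < m%:R by rewrite ltr0n.
have zm : zeta R m ^+ m = 1.
  rewrite zeta_exp -[_ *+ m]mulr_natr divfK ?gt_eqF// [2 * pi]mulr_natl.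
  by rewrite cos2pi sin2pi.
have [k pk km] := prim_order_exists m0 zm.
have k0 := prim_order_gt0 pk.
suff e : m = k by rewrite {1}e.
apply/eqP; rewrite eqn_leq (dvdn_leq m0 km) andbT leqNgt; apply/negP => ltkm.
have := prim_expr_order pk; rewrite zeta_exp => /(congr1 (@complex.Re R)) /=.
set y : R := pi / m%:R *+ k.
have -> : 2 * pi / m%:R *+ k = y *+ 2 by rewrite -mulrA -mulrnAr mulr_natl.
have ypos : 0 < y by rewrite /y pmulrn_lgt0 // divr_gt0 ?pi_gt0.
have ypi : y < pi.
  rewrite /y -mulr_natr -mulrA -[ltRHS]mulr1 ltr_pM2l ?pi_gt0//.
  by rewrite mulrC ltr_pdivrMr// mul1r ltr_nat.
have sy : 0 < sin y by apply: sin_gt0_pi; rewrite ypos ypi.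
rewrite mulr2n cosD => h; have := cos2Dsin2 y; nra.
Qed.

Definition J (a b m : nat) (c d : int) : seq int :=
  let lo := Num.ceil ((c * m%:Z)%:~R / a%:R : rat) in
  let hi := Num.floor ((d * m%:Z)%:~R / b%:R : rat) in
  if lo <= hi then [seq lo + k%:Z | k <- iota 0 `|hi - lo|.+1] else [::].

Lemma mem_J (a b m : nat) (c d n : int) :
  (n \in J a b m c d) =
  ((c * m%:Z)%:~R / a%:R <= n%:~R :> rat) &&
  (n%:~R <= (d * m%:Z)%:~R / b%:R :> rat).
Proof.
rewrite /J -Num.Theory.ceil_le_int -Num.Theory.floor_ge_int.
set lo := Num.ceil _; set hi := Num.floor _.
case: (lerP lo hi) => [le|lt]; last first.
  by apply/esym/negP => /andP[h1 h2]; move: (le_trans h1 h2); rewrite leNgt lt.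
apply/mapP/andP => [[k + ->]|[h1 h2]].
  rewrite mem_iota add0n ltnS => /= h; rewrite lerDl; split => //.
  by rewrite -lerBrDl -(gez0_abs (_ : 0 <= hi - lo)) ?subr_ge0// lez_nat.
exists `|n - lo|%N; last by rewrite gez0_abs ?subr_ge0// [RHS]addrC subrK.
rewrite mem_iota add0n ltnS /= -lez_nat !gez0_abs ?subr_ge0//.
by rewrite lerD2r.
Qed.

Lemma uniq_J (a b m : nat) (c d : int) : uniq (J a b m c d).
Proof.
rewrite /J; case: ifP => // _; rewrite map_inj_uniq ?iota_uniq//.
by move=> i j /addrI [].
Qed.

(* The coordinate of index k lies in the summand C(n) with n = J`_k. *)
Notation lambdabar R a b m c d := 'rV[C R]_(size (J a b m c d)).

(* The inclusion of the summand C(n); it is zero when n is not in J. *)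
Definition summand_incl (R : realType) (a b m : nat) (c d n : int) (w : C R) :
    lambdabar R a b m c d :=
  \row_k (if (J a b m c d)`_k == n then w else 0).

Definition summand (R : realType) (a b m : nat) (c d n : int) :
    set (lambdabar R a b m c d) :=
  range (@summand_incl R a b m c d n).

Definition summand_roots (R : realType) (a b m : nat) (c d n : int) (q : nat) :
    set (lambdabar R a b m c d) :=
  @summand_incl R a b m c d n @` [set w | q.-unity_root w].

(* R[C_m] is {ffun 'I_m -> R}: the value at r is the coefficient of the basis
   element zeta_m^r, and r |-> zeta_m^r is a bijection onto C_m by zeta_prim. *)
Definition xmap (R : realType) (a b m : nat) (c d : int)
    (t : {ffun 'I_m -> R}) : lambdabar R a b m c d :=
  \sum_(r < m) ((t r)%:C : C R) *:
    (\row_k (zeta R m ^+ r) ^ (J a b m c d)`_k).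

Definition Delta (R : realType) (m : nat) : set {ffun 'I_m -> R} :=
  [set t | (forall r, 0 <= t r) /\ \sum_(r < m) t r = 1].

Definition face (R : realType) (m : nat) (F : {set 'I_m}) :
    set {ffun 'I_m -> R} :=
  [set t | @Delta R m t /\ forall r, r \notin F -> t r = 0].

(* The convex hull of the points (z^n)_(n in J), z in C_m, as an image. *)
Definition polytope (R : realType) (a b m : nat) (c d : int) :
    set (lambdabar R a b m c d) :=
  @xmap R a b m c d @` @Delta R m.

(* Taken in the whole space: P is only viewed as a subset of lambdabar, and no
   relative interior in its affine span is involved. *)
Definition boundary (T : topologicalType) (A : set T) : set T :=
  closure A `\` interior A.

Definition exponents (m : nat) (F : {set 'I_m}) : seq nat :=
  [seq nat_of_ord r | r <- enum F].

Lemma exponents_sorted (m : nat) (F : {set 'I_m}) : sorted ltn (exponents F).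
Proof.
rewrite /exponents sorted_map.
apply: (@subseq_sorted _ _ _ _ (enum 'I_m)); first 1 last.
- by rewrite !enumT; exact: filter_subseq.
- by rewrite -sorted_map val_enum_ord iota_ltn_sorted.
by move=> x y z /=; exact: ltn_trans.
Qed.

Definition gaps (m : nat) (rs : seq nat) : seq nat :=
  if rs is r :: rs' then
    rcons (pairmap (fun p q => q - p)%N r rs') (r + m - last r rs')%N
  else [::].

Definition representable (a b n : nat) : Prop :=
  exists i j : nat, n = (a * i + b * j)%N.

Definition Sigma_simplex (a b m : nat) (F : {set 'I_m}) : Prop :=
  (0 < #|F|)%N /\
  (forall g, g \in gaps m (exponents F) -> representable a b g).

Definition Sigma (R : realType) (a b m : nat) : set {ffun 'I_m -> R} :=
  \bigcup_(F in [set F | @Sigma_simplex a b m F]) @face R m F.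

Definition Q (R : realType) (a b m : nat) (c d : int) :
    set (lambdabar R a b m c d) :=
  @xmap R a b m c d @` @Sigma R a b m.

(* Main.v *)
(* A pair (I, K) of nonnegative integers with a I + b K = m corresponds to the
   element n = c I + d K of J, and positive pairs to interior points of the
   interval. The gaps of a simplex F of Sigma split as a i + b j, so F is a
   monotone lattice path from (0, 0) to such a pair (I, K). As a n = K and
   b n = - I modulo m, a point of the path at (A, B) has n-th coordinate of
   argument 2 pi (K A - I B) / m up to a constant; these arguments lie in an
   interval of length 2 pi I K / m, and 2 I K <= m because at most one pair is
   positive, with equality only for (I, K) = (b, a). Hence the n-th coordinate
   of a point of x(F) does not vanish, except for some antipodal pairs when
   m = 2 a b, and then the coordinates n - 1 and n + 1 do not vanish.
   If a or b divides m, residue classes modulo a or b give the roots of unity.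
   If neither does, J is empty or J = {n}; then P is a regular k-gon with
   k = m / gcd(I, K), and a Bezout relation A K = B I + gcd(I, K) with
   0 <= A <= I and 0 <= B <= K shows that its edges are images of edges of
   Sigma. *)

Require Import Defs.
From mathcomp Require Import all_boot all_order all_algebra.
From mathcomp Require Import complex.
From mathcomp Require Import all_classical all_reals all_analysis.
From mathcomp Require Import zify ring lra.

Set Implicit Arguments.
Unset Strict Implicit.
Unset Printing Implicit Defensive.

Import Order.TTheory GRing.Theory Num.Theory.
Import numFieldNormedType.Exports.
Local Open Scope classical_set_scope.
Local Open Scope ring_scope.
Local Open Scope complex_scope.

(** * Pairs with a I + b K = m and the set J *)

Section Representations.

Variables (a b m : nat).
Hypotheses (a0 : (0 < a)%N) (b0 : (0 < b)%N).

Lemma ell_le1_uniq (I J I' J' : nat) :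
  (ell a b m <= 1)%N -> (0 < I)%N -> (0 < J)%N -> (0 < I')%N -> (0 < J')%N ->
  (a * I + b * J)%N = m -> (a * I' + b * J')%N = m -> I = I' /\ J = J'.
Proof.
move=> /card_le1_eqP ell1 I0 J0 I'0 J'0 e e'.
have [lI lJ lI' lJ'] : [/\ (I < m.+1)%N, (J < m.+1)%N, (I' < m.+1)%N
  & (J' < m.+1)%N] by split; nia.
have := ell1 (Ordinal lI, Ordinal lJ) (Ordinal lI', Ordinal lJ').
rewrite !inE /= I0 J0 I'0 J'0 e e' eqxx => /(_ isT isT) [-> ->].
by [].
Qed.

(** Clearing denominators, the two bounds of the interval say that d m - b n and a n - c m are
    nonnegative; by determinant one, (I, K) and (m, n) determine each other linearly. *)
Lemma memJ_solution (c d n : int) : a%:Z * d - b%:Z * c = 1 ->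
  n \in J a b m c d <-> exists I K : nat, [/\ (a * I + b * K)%N = m,
    n = c * I%:Z + d * K%:Z, I%:Z = d * m%:Z - b%:Z * n
    & K%:Z = a%:Z * n - c * m%:Z].
Proof.
move=> hcd; rewrite mem_J ler_pdivrMr ?ltr0n// ler_pdivlMr ?ltr0n//.
rewrite (pmulrn 1 a) (pmulrn 1 b) -!intrM !ler_int.
split=> [/andP[h1 h2]|[I [K [e1 e2 e3 e4]]]]; last by apply/andP; split; lia.
exists (absz (d * m%:Z - b%:Z * n)%R), (absz (a%:Z * n - c * m%:Z)%R).
rewrite !gez0_abs; [|lia|lia].
split=> //.
  apply/eqP; rewrite -eqz_nat PoszD !PoszM !gez0_abs; [|lia|lia].
  by apply/eqP; rewrite -[RHS]mul1r -hcd; ring.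
by rewrite -[LHS]mul1r -hcd; ring.
Qed.

(** For positive I and K, having I > b would make (I - b, K + a) a second positive pair; so I <= b,
    likewise K <= a, and adding I K <= a I and I K <= b K gives the bound. *)
Lemma solution_bounds (I K : nat) :
  (0 < m)%N -> (ell a b m <= 1)%N -> (a * I + b * K)%N = m ->
  (2 * (I * K) <= m)%N /\
  ((m <= 2 * (I * K))%N -> [/\ I = b, K = a & m = (2 * (a * b))%N]).
Proof.
move=> m0 ell1 e.
case: (posnP I) => [I0|I0]; first by split; nia.
case: (posnP K) => [K0|K0]; first by split; nia.
have Ib : (I <= b)%N.
  rewrite leqNgt; apply/negP => lt.
  have := @ell_le1_uniq I K (I - b) (K + a) ell1 I0 K0.
  rewrite subn_gt0 addn_gt0 K0 lt => /(_ isT isT e).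
  by rewrite mulnBr mulnDr; nia.
have Ka : (K <= a)%N.
  rewrite leqNgt; apply/negP => lt.
  have := @ell_le1_uniq I K (I + b) (K - a) ell1 I0 K0.
  rewrite subn_gt0 addn_gt0 I0 lt => /(_ isT isT e).
  by rewrite mulnBr mulnDr; nia.
have h1 : (I * K <= a * I)%N by nia.
have h2 : (I * K <= b * K)%N by nia.
split; first by lia.
move=> h3.
have h4 : (I * K = a * I)%N by lia.
have h5 : (I * K = b * K)%N by lia.
by split; nia.
Qed.

End Representations.

(** * Simplices of Sigma as monotone lattice paths *)

Section Faces.

Variables (a b m : nat).

(** Splitting each gap as a i + b j and adding up along the chain gives the lattice path; [A] and
    [B] are constrained only at the vertices. *)
Lemma chain_potential (x : nat) (s : seq nat) :
  path ltn x s ->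
  (forall g, g \in pairmap (fun p q => q - p)%N x s -> representable a b g) ->
  exists A B : nat -> nat,
    {in x :: s, forall y, y = x + a * A y + b * B y}%N /\
    {in x :: s &, forall y z, (y <= z)%N -> (A y <= A z)%N /\ (B y <= B z)%N}.
Proof.
elim: s x => [|y s IH] x /=.
  move=> _ _; exists (fun=> 0%N), (fun=> 0%N); split=> //.
  by move=> z; rewrite inE => /eqP ->; rewrite !muln0 !addn0.
move=> /andP[xy ys] rep.
have [g gs|A [B [AB mon]]] := IH y ys; first by apply: rep; rewrite inE gs orbT.
have [|i [j ij]] := rep (y - x)%N; first by rewrite inE eqxx.
have lt_x z : z \in y :: s -> (x < z)%N.
  rewrite inE => /predU1P[-> //|zs]; apply: ltn_trans xy _.
  by move: ys; rewrite (path_sortedE ltn_trans) => /andP[/allP/(_ z zs)].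
exists (fun z => if z == x then 0 else i + A z)%N.
exists (fun z => if z == x then 0 else j + B z)%N; split.
  move=> z; rewrite inE; case: (eqVneq z x) => [-> _|zx /= zs].
    by rewrite !muln0 !addn0.
  by rewrite {1}(AB z zs) !mulnDr; lia.
move=> z w; rewrite (in_cons x _ z) (in_cons x _ w).
case: (eqVneq z x) => [//|zx /= zs].
case: (eqVneq w x) => [-> _ zlex|wx /= ws zw].
  by have := lt_x z zs; rewrite ltnNge zlex.
by have [h1 h2] := mon z w zs ws zw; rewrite !leq_add2l.
Qed.

Lemma path_ltn_last (x : nat) (s : seq nat) : path ltn x s ->
  {in x :: s, forall y, (y <= last x s)%N}.
Proof.
elim: s x => [|z s IH] x /=; first by move=> _ y; rewrite inE => /eqP ->.
move=> /andP[xz zs] y; rewrite inE => /predU1P[->|]; last exact: IH.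
by apply: leq_trans (ltnW xz) (IH z zs z _); rewrite mem_head.
Qed.

(** The gap that closes the circle extends the path from the last vertex to its end point (I, K). *)
Lemma simplex_potential (F : {set 'I_m}) : Sigma_simplex a b F ->
  exists (I K r1 : nat) (A B : nat -> nat),
    [/\ (a * I + b * K)%N = m,
      {in F, forall r : 'I_m, r = r1 + a * A r + b * B r :> nat}%N,
      {in F, forall r : 'I_m, (A r <= I)%N /\ (B r <= K)%N} &
      {in F &, forall r r' : 'I_m,
        (r <= r')%N -> (A r <= A r')%N /\ (B r <= B r')%N}].
Proof.
move=> [F0 rep]; have srt := exponents_sorted F.
have memF (r : 'I_m) : r \in F -> (r : nat) \in exponents F.
  by move=> rF; apply: map_f; rewrite mem_enum.
have ltm y : y \in exponents F -> (y < m)%N by case/mapP=> z _ ->.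
case E : (exponents F) (srt) (rep) => [|x s] /= xs rep'.
  have := size_map (@nat_of_ord m) (enum F).
  by rewrite -/(exponents F) E -cardE; case: #|F| F0.
have [g gs|A [B [AB mon]]] := chain_potential xs.
  by apply: rep'; rewrite mem_rcons inE gs orbT.
have [|i [j ij]] := rep' (x + m - last x s)%N.
  by rewrite mem_rcons inE eqxx.
have lastM := path_ltn_last xs.
exists (A (last x s) + i)%N, (B (last x s) + j)%N, x, A, B.
have lin := mem_last x s.
have := ltm (last x s); rewrite E => /(_ lin) lastm.
have e := AB _ lin.
split.
- move: (last x s) e ij lastm => l; move: (A l) (B l) => p q e ij lm.
  by rewrite !mulnDr; lia.
- by move=> r /memF; rewrite E => /AB.
- move=> r /memF; rewrite E => rF; have [h1 h2] := mon _ _ rF lin (lastM _ rF).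
  by split; apply: leq_trans (leq_addr _ _).
by move=> r r' /memF + /memF; rewrite E => h h'; exact: mon.
Qed.


Lemma mem_pairmap_subn (x g : nat) (s : seq nat) : path ltn x s ->
  g \in pairmap (fun p q => q - p)%N x s ->
  exists p q, [/\ p \in x :: s, q \in x :: s, (p <= q)%N & g = (q - p)%N].
Proof.
elim: s x => [//|y s IH] x /= /andP[xy ys]; rewrite inE => /predU1P[->|gs].
  by exists x, y; rewrite !inE !eqxx orbT; split=> //; exact: ltnW.
have [p [q [ps qs pq ->]]] := IH y ys gs.
by exists p, q; split=> //; rewrite in_cons ?ps ?qs orbT.
Qed.

Lemma mem_gaps (F : {set 'I_m}) (g : nat) : g \in gaps m (exponents F) ->
  exists r r' : 'I_m, [/\ r \in F, r' \in F, (r <= r')%N &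
    g = (r' - r)%N \/ g = (r + m - r')%N].
Proof.
have memF p : p \in exponents F -> exists2 r : 'I_m, r \in F & p = r.
  by case/mapP=> r; rewrite mem_enum => rF ->; exists r.
case E : (exponents F) (exponents_sorted F) => [//|x s] /= xs.
rewrite mem_rcons inE => /predU1P[->|gs].
  have [|r rF er] := memF x; first by rewrite E mem_head.
  have [|r' rF' er'] := memF (last x s); first by rewrite E mem_last.
  exists r, r'; rewrite -er -er'; split=> //; last by right.
  by apply: path_ltn_last xs _ _; rewrite mem_head.
have [p [q [+ + pq ->]]] := mem_pairmap_subn xs gs.
rewrite -E => /memF[r rF er] /memF[r' rF' er'].
by exists r, r'; rewrite -er -er'; split=> //; left.
Qed.

(** Asking the condition of all pairs avoids sorting the vertices; r = r' covers the gap m of a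
    single vertex. *)
Lemma Sigma_simplex_intro (F : {set 'I_m}) : (0 < #|F|)%N ->
  {in F &, forall r r' : 'I_m, (r <= r')%N ->
    representable a b (r' - r) /\ representable a b (r + m - r')} ->
  Sigma_simplex a b F.
Proof.
move=> F0 rep; split=> // g /mem_gaps[r [r' [rF rF' rr']]].
by have [h1 h2] := rep r r' rF rF' rr'; case=> ->.
Qed.

End Faces.

(** * Coordinates as weighted sums of roots of unity *)

Section Coordinates.

Variables (R : realType) (m : nat).
Hypothesis m0 : (0 < m)%N.
Local Notation z := (zeta R m).

(** The exponent is any integer rather than a position in J, so that n - 1 and n + 1 can be treated
    before they are known to lie in J. *)
Definition coord (t : {ffun 'I_m -> R}) (n : int) : C R :=
  \sum_(r < m) ((t r)%:C : C R) * (z ^+ r) ^ n.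

Lemma xmap_coord (a b : nat) (c d : int) (t : {ffun 'I_m -> R}) i k :
  xmap a b c d t i k = coord t (J a b m c d)`_k.
Proof.
rewrite /xmap summxE; apply: eq_bigr => r _.
by rewrite !mxE.
Qed.

Lemma zeta_neq0 : z != 0.
Proof. by rewrite (prim_root_eq0 (zeta_prim R m0)) -lt0n. Qed.

Lemma zetaX_neq0 k : z ^+ k != 0.
Proof. by rewrite expf_neq0 ?zeta_neq0. Qed.

Lemma expz_zeta_mod (x y k : int) : x = y + m%:Z * k -> z ^ x = z ^ y.
Proof.
move=> ->; rewrite expfzDr ?zeta_neq0// -exprz_exp -exprnP.
by rewrite prim_expr_order ?zeta_prim// exp1rz mulr1.
Qed.

Lemma Im_zetaX_ge0 k : (2 * k <= m)%N -> 0 <= complex.Im (z ^+ k).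
Proof.
move=> km; rewrite zeta_exp /=; apply: sin_ge0_pi.
have m0R : (0 : R) < m%:R by rewrite ltr0n.
rewrite -mulr_natr; apply/andP; split.
  by rewrite !mulr_ge0 ?invr_ge0 ?pi_ge0 ?ler0n.
rewrite mulrAC ler_pdivrMr// mulrAC mulrC ler_pM2l ?pi_gt0//.
by rewrite -natrM ler_nat.
Qed.

Lemma Im_zetaX_eq0 k : (2 * k <= m)%N -> complex.Im (z ^+ k) = 0 ->
  k = 0%N \/ (2 * k)%N = m.
Proof.
move=> km; rewrite zeta_exp /=.
case: (posnP k) => [->|k0]; first by left.
move: km; rewrite leq_eqVlt => /predU1P[->|km]; first by right.
have m0R : (0 : R) < m%:R by rewrite ltr0n.
suff /gt_eqF h : 0 < sin (2 * pi / m%:R *+ k : R) by move=> /eqP; rewrite h.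
apply: sin_gt0_pi; rewrite -mulr_natr; apply/andP; split.
  by rewrite !mulr_gt0 ?invr_gt0 ?pi_gt0 ?ltr0n.
rewrite mulrAC ltr_pdivrMr// mulrAC mulrC ltr_pM2l ?pi_gt0//.
by rewrite -natrM ltr_nat.
Qed.

Lemma Im_wsum (I : finType) (t : I -> R) (y : I -> C R) :
  complex.Im (\sum_i ((t i)%:C : C R) * y i) = \sum_i t i * complex.Im (y i).
Proof.
rewrite (big_morph (@complex.Im R : C R -> R) (id1 := 0) (op1 := +%R)) //.
  by apply: eq_bigr => i _; case: (y i) => u v /=; rewrite mul0r addr0.
by case=> u v [].
Qed.

Lemma Re_wsum (I : finType) (t : I -> R) (y : I -> C R) :
  complex.Re (\sum_i ((t i)%:C : C R) * y i) = \sum_i t i * complex.Re (y i).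
Proof.
rewrite (big_morph (@complex.Re R : C R -> R) (id1 := 0) (op1 := +%R)) //.
  by apply: eq_bigr => i _; case: (y i) => u v /=; rewrite mul0r subr0.
by case=> u v [].
Qed.

Lemma sum_real_complex (I : finType) (t : I -> R) :
  \sum_i ((t i)%:C : C R) = (\sum_i t i)%:C.
Proof. by rewrite -(rmorph_sum (real_complex R)). Qed.

(** The weighted imaginary parts are nonnegative reals with sum 0. *)
Lemma Im_wsum_eq0 (I : finType) (t : I -> R) (y : I -> C R) :
  (forall i, 0 <= t i) -> (forall i, t i != 0 -> 0 <= complex.Im (y i)) ->
  \sum_i ((t i)%:C : C R) * y i = 0 ->
  forall i, t i != 0 -> complex.Im (y i) = 0.
Proof.
move=> t0 y0 /(congr1 (@complex.Im R)); rewrite Im_wsum => s0 i ti.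
have ge0 j : true -> 0 <= t j * complex.Im (y j).
  by move=> _; case: (eqVneq (t j) 0) => [->|tj]; rewrite ?mul0r// mulr_ge0 ?y0.
have /eqP := psumr_eq0P ge0 s0 (i := i) isT.
by rewrite mulf_eq0 (negbTE ti) => /eqP.
Qed.

End Coordinates.

(** * Non-vanishing of coordinates on a simplex of Sigma *)

Lemma coprime_balanced (a b x y : nat) (c d : int) : (0 < a)%N -> (0 < b)%N ->
  a%:Z * d - b%:Z * c = 1 -> (a * x = b * y)%N ->
  exists q, x = (b * q)%N /\ y = (a * q)%N.
Proof.
move=> a0 b0 hcd e.
have cop : coprime a b.
  rewrite -[coprime _ _]/(coprimez a b); apply/coprimezP.
  by exists (d, - c); rewrite /= -hcd; ring.
have : (b %| a * x)%N by rewrite e dvdn_mulr.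
rewrite Gauss_dvdr 1?coprime_sym// => /dvdnP[q xq].
exists q; split; first by rewrite xq mulnC.
by apply/eqP; rewrite -(eqn_pmul2l b0) -e xq; apply/eqP; ring.
Qed.

(** Here x and y are the steps of the path between two vertices when m = 2 a b. If k = a b, one of a
    x, b y is a b and the other 0; if k = 0, coprimality gives (x, y) = q (b, a), and q > 0 would be
    a full turn. *)
Lemma balanced_step (a b x y k : nat) (c d : int) : (0 < a)%N -> (0 < b)%N ->
  a%:Z * d - b%:Z * c = 1 -> k = 0%N \/ k = (a * b)%N ->
  (x <= b)%N -> (y <= a)%N -> (a * x + b * y < 2 * (a * b))%N ->
  (a * x = b * y + k \/ b * y = a * x + k)%N -> (a * x + b * y = k)%N.
Proof.
move=> a0 b0 hcd kab xb ya lt.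
have ax : (a * x <= a * b)%N by rewrite leq_mul2l xb orbT.
have by_ : (b * y <= a * b)%N by rewrite mulnC leq_mul2r ya orbT.
case: kab => -> bal; last by lia.
have e : (a * x = b * y)%N by lia.
have [[|q] [xq yq]] := coprime_balanced a0 b0 hcd e.
  by rewrite xq yq !muln0.
by move: lt; rewrite xq yq !mulnA ![(_ * q.+1)%N]mulnS; lia.
Qed.

(** Used with u = 1 or -1 and w of square 1: the sign that separates x from y also separates their
    n-th powers, so it cancels in the exponents n + 1 and n - 1. *)
Lemma exprz_shift (K : fieldType) (x y w : K) (n u : int) :
  y != 0 -> w != 0 -> x ^ n = y ^ n * w -> x = y * w -> w * w ^ u = 1 ->
  x ^ (n + u) = y ^ (n + u).
Proof.
move=> y0 w0 xn xE wu; have x0 : x != 0 by rewrite xE mulf_neq0.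
by rewrite !expfzDr// xn xE expfzMl mulrACA wu mulr1.
Qed.

Lemma coord_simplex (R : realType) (a b m : nat) (c d : int)
    (F : {set 'I_m}) (t : {ffun 'I_m -> R}) :
  (0 < a)%N -> (0 < b)%N -> (0 < m)%N -> a%:Z * d - b%:Z * c = 1 ->
  (ell a b m <= 1)%N -> Sigma_simplex a b F -> face F t ->
  exists I K : nat, let n := c * I%:Z + d * K%:Z in
    [/\ (a * I + b * K)%N = m,
        (I * K = 0)%N -> exists r : 'I_m, coord t n = (zeta R m ^+ r) ^ n &
        coord t n = 0 -> [/\ I = b, K = a,
          coord t (n + 1) != 0 & coord t (n - 1) != 0]].
Proof.
move=> a0 b0 m0 hcd ell1 simF [[t0 t1] tF].
have [I [K [r1 [A [B [IK rAB AB_le AB_mon]]]]]] := simplex_potential simF.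
exists I, K => n; set z := zeta R m.
have [le_m eq_m] := solution_bounds a0 b0 m0 ell1 IK.
have [F0 _] := simF; have /card_gt0P[i0 i0F] := F0.
(* Up to a constant and modulo m, [e r] is the exponent of zeta_m in the n-th coordinate of the
   vertex r. *)
pose e (r : 'I_m) : int := K%:Z * (A r)%:Z - I%:Z * (B r)%:Z.
have [r0 r0F r0_min] : exists2 r0, r0 \in F & {in F, forall r, e r0 <= e r}.
  by case: (@Order.TotalTheory.arg_minP _ _ _ i0 (mem F) e i0F) => r0; exists r0.
pose k (r : 'I_m) := absz (e r - e r0).
have kE r : r \in F -> (k r)%:Z = e r - e r0.
  by move=> rF; rewrite gez0_abs// subr_ge0 r0_min.
have KE : K%:Z = a%:Z * n - c * m%:Z.
  have h : K%:Z * (a%:Z * d - b%:Z * c) = K%:Z by rewrite hcd mulr1.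
  by rewrite /n -IK PoszD !PoszM; lia.
have IE : I%:Z = d * m%:Z - b%:Z * n.
  have h : I%:Z * (a%:Z * d - b%:Z * c) = I%:Z by rewrite hcd mulr1.
  by rewrite /n -IK PoszD !PoszM; lia.
clearbody n.
have zrn r : r \in F -> (z ^+ r) ^ n = (z ^+ r0) ^ n * z ^+ k r.
  move=> rF; rewrite !exprnP !exprz_exp -expfzDr ?zeta_neq0//.
  (* As a n = K + c m and b n = d m - I, the multiple of m that is dropped is c times the change of
     A plus d times that of B. *)
  apply: (expz_zeta_mod R m0
    (k := c * ((A r)%:Z - (A r0)%:Z) + d * ((B r)%:Z - (B r0)%:Z))).
  rewrite kE// /e KE IE; move: (rAB r rF) (rAB r0 r0F).
  move: (A r) (A r0) (B r) (B r0) => Ar A0 Br B0 -> ->.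
  by rewrite !PoszD !PoszM; ring.
(* By monotonicity A and B change in the same direction, so only one of the two terms of
   [e r - e r0] can be positive, and that one is at most I K. *)
have kIK r : r \in F -> (k r <= I * K)%N.
  move=> rF; rewrite -lez_nat kE// PoszM /e.
  have [hA hB] := AB_le r rF; have [hA0 hB0] := AB_le r0 r0F.
  case/orP: (leq_total r r0) => rr.
    have [h1 h2] := AB_mon r r0 rF r0F rr.
    have : (I * (B r0 - B r) <= I * K)%N by rewrite leq_mul2l; lia.
    rewrite mulnBr.
    have : (K * A r <= K * A r0)%N by rewrite leq_mul2l h1 orbT.
    by lia.
  have [h1 h2] := AB_mon r0 r r0F rF rr.
  have : (K * (A r - A r0) <= I * K)%N by rewrite mulnC leq_mul2r; lia.
  rewrite mulnBr.
  have : (I * B r0 <= I * B r)%N by rewrite leq_mul2l h2 orbT.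
  by lia.
have tF' r : t r != 0 -> r \in F by apply: contra_neqT => /tF.
have coordE : coord t n = (z ^+ r0) ^ n * \sum_r ((t r)%:C : C R) * z ^+ k r.
  rewrite /coord mulr_sumr; apply: eq_bigr => r _.
  case: (eqVneq (t r) 0) => [->|/tF'/zrn ->]; first by rewrite !mul0r mulr0.
  by rewrite mulrCA.
have sum1 : \sum_r ((t r)%:C : C R) = 1 by rewrite sum_real_complex t1.
have wsum1 (y : 'I_m -> C R) : (forall r, t r != 0 -> y r = 1) ->
    \sum_r ((t r)%:C : C R) * y r = 1.
  move=> y1; rewrite -sum1; apply: eq_bigr => r _.
  by case: (eqVneq (t r) 0) => [->|/y1 ->]; rewrite ?mul0r ?mulr1.
split=> //.
  move=> IK0; exists r0; rewrite coordE wsum1 ?mulr1// => r /tF' rF.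
  by have := kIK r rF; rewrite IK0 leqn0 => /eqP ->.
move=> /eqP; rewrite coordE mulf_eq0.
rewrite (negbTE (expfz_neq0 _ (zetaX_neq0 R m0 _))).
move=> /eqP sum0.
(* The choice of r0 puts all the z ^+ k r in the closed upper half-plane. *)
have k_le r : r \in F -> (2 * k r <= m)%N.
  by move=> rF; apply: leq_trans le_m; rewrite leq_mul2l kIK.
have k_cases r : t r != 0 -> k r = 0%N \/ (2 * k r)%N = m.
  move=> tr; apply: (@Im_zetaX_eq0 R) => //; first exact: k_le (tF' r tr).
  apply: (Im_wsum_eq0 t0 _ sum0 tr) => r' /tF' r'F.
  exact: (Im_zetaX_ge0 R m0 (k_le r' r'F)).
(* If every contributing [k r] were 0, the weighted sum would be 1; so some 2 [k r] equals m, which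
   is the equality case of the bound 2 I K <= m. *)
have [Ib Ka mE] : [/\ I = b, K = a & m = (2 * (a * b))%N].
  have [r tr kr] : exists2 r, t r != 0 & (2 * k r)%N = m.
    apply/not_exists2P => none; move: sum0.
    rewrite wsum1; first exact/eqP/oner_neq0.
    by move=> r tr; have [->//|kr] := k_cases r tr; case: (none r).
  by apply: eq_m; rewrite -kr leq_mul2l kIK ?orbT// tF'.
have kab r : t r != 0 -> k r = 0%N \/ k r = (a * b)%N.
  by move=> /k_cases[->|]; [left|rewrite mE => h; right; lia].
have z2k r : t r != 0 -> z ^+ k r * z ^+ k r = 1.
  move=> /k_cases kr; rewrite -exprD addnn -mul2n.
  by case: kr => ->; rewrite ?muln0 ?expr0// (prim_expr_order (zeta_prim R m0)).
(* The distance from [r0] to r along the circle is [k r] by [balanced_step]; its direction is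
   irrelevant because the factor has square 1. *)
have z_r r : t r != 0 -> z ^+ r = z ^+ r0 * z ^+ k r.
  move=> tr; have rF := tF' r tr; have := kE r rF; rewrite /e Ib Ka.
  have [hA hB] := AB_le r rF; have [hA0 hB0] := AB_le r0 r0F.
  have lt : (r < 2 * (a * b))%N by rewrite -mE.
  have lt0 : (r0 < 2 * (a * b))%N by rewrite -mE.
  have step := fun x y => @balanced_step a b x y (k r) c d a0 b0 hcd (kab r tr).
  case/orP: (leq_total r0 r) => rr.
    have [h1 h2] := AB_mon r0 r r0F rF rr => kr.
    rewrite -exprD; congr (_ ^+ _).
    move: (rAB r rF) (rAB r0 r0F) kr h1 h2 hA hB hA0 hB0.
    move: (A r) (A r0) (B r) (B r0) => A1 A0 B1 B0 e1 e0 kr h1 h2 hA hB hA0 hB0.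
    have q1 : (a * A0 <= a * A1)%N by rewrite leq_mul2l h1 orbT.
    have q2 : (b * B0 <= b * B1)%N by rewrite leq_mul2l h2 orbT.
    have : (a * (A1 - A0) + b * (B1 - B0) = k r)%N.
      by apply: step; rewrite ?mulnBr; lia.
    by rewrite !mulnBr; lia.
  have [h1 h2] := AB_mon r r0 rF r0F rr => kr.
  rewrite -[LHS]mulr1 -(z2k r tr) mulrA -exprD; congr (_ ^+ _ * _).
  move: (rAB r rF) (rAB r0 r0F) kr h1 h2 hA hB hA0 hB0.
  move: (A r) (A r0) (B r) (B r0) => A1 A0 B1 B0 e1 e0 kr h1 h2 hA hB hA0 hB0.
  have q1 : (a * A1 <= a * A0)%N by rewrite leq_mul2l h1 orbT.
  have q2 : (b * B1 <= b * B0)%N by rewrite leq_mul2l h2 orbT.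
  have : (a * (A0 - A1) + b * (B0 - B1) = k r)%N.
    by apply: step; rewrite ?mulnBr; lia.
  by rewrite !mulnBr; lia.
have shift (u : int) : (u = 1 \/ u = -1) ->
    coord t (n + u) = (z ^+ r0) ^ (n + u).
  move=> hu.
  have pw r : t r != 0 -> (z ^+ r) ^ (n + u) = (z ^+ r0) ^ (n + u).
    move=> tr; have zk : z ^+ k r * (z ^+ k r) ^ u = 1.
      by case: hu => ->; [exact: z2k|rewrite mulfV ?zetaX_neq0].
    exact: (exprz_shift (zetaX_neq0 R m0 _) (zetaX_neq0 R m0 _)
      (zrn r (tF' r tr)) (z_r r tr) zk).
  rewrite -[RHS]mul1r -sum1 mulr_suml /coord; apply: eq_bigr => r _.
  by case: (eqVneq (t r) 0) => [->|/pw ->]; rewrite ?mul0r.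
by split=> //; rewrite shift ?expfz_neq0 ?zetaX_neq0//; [left|right].
Qed.

(** * Residue classes and roots of unity *)

Section SummandPoints.

Variables (R : realType) (m : nat).
Hypothesis m0 : (0 < m)%N.
Local Notation z := (zeta R m).

Lemma expz_zeta_eq1 (x : int) : (z ^ x == 1) = (m%:Z %| x)%Z.
Proof.
have -> : z ^ x = z ^+ absz (x %% m%:Z)%Z.
  rewrite exprnP gez0_abs ?modz_ge0//; last by rewrite gt_eqF.
  apply: (@expz_zeta_mod R m m0 _ _ (x %/ m%:Z)%Z).
  by rewrite {1}(divz_eq x m) addrC mulrC.
rewrite -(prim_order_dvd (zeta_prim R m0)).
rewrite -[LHS]/(m%:Z %| `|(x %% m%:Z)%Z|%N%:Z)%Z.
rewrite gez0_abs ?modz_ge0//; last by rewrite gt_eqF.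
by apply/dvdz_mod0P/dvdz_mod0P; rewrite modz_mod.
Qed.

Lemma sum_residue (V : nmodType) (p q r0 : nat) (f : nat -> V) : (r0 < q)%N ->
  \sum_(r < p * q | (r %% q == r0)%N) f r = \sum_(k < p) f (r0 + q * k)%N.
Proof.
move=> r0q; rewrite -(big_mkord (fun r => r %% q == r0)%N).
elim: p => [|p IH]; first by rewrite mul0n big_geq// big_ord0.
rewrite big_ord_recr /= -IH mulSn addnC.
rewrite (@big_cat_nat _ _ _ (p * q)%N) ?leq_addr//=.
congr (_ + _); rewrite -{1}[(p * q)%N]add0n big_addn addKn big_mkord.
rewrite (big_pred1 (Ordinal r0q)) /=; first by rewrite mulnC.
by move=> i; rewrite /= addnC modnMDl modn_small.
Qed.

Lemma sum_powers_eq0 (K : idomainType) (p : nat) (v : K) :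
  v ^+ p = 1 -> v != 1 -> \sum_(k < p) v ^+ k = 0.
Proof.
move=> vp v1; apply/eqP; have := subrX1 v p.
by rewrite vp subrr => /esym/eqP; rewrite mulf_eq0 subr_eq0 (negbTE v1).
Qed.

(** Writing w as the i-th power of zeta_m^(m/q), the residue is u i modulo q, since u inverts e
    there. *)
Lemma root_of_unity_zeta (q : nat) (w : C R) (e u v : int) : (0 < q)%N ->
  (q %| m)%N -> e * u = 1 + q%:Z * v -> w ^+ q = 1 ->
  exists2 r0, (r0 < q)%N & w = (z ^+ r0) ^ (e * (m %/ q)%:Z).
Proof.
move=> q0 qm eu wq.
have pz := dvdn_prim_root (zeta_prim R m0) qm.
have [i ->] := prim_rootP pz wq.
have q0Z : q%:Z != 0 by rewrite gt_eqF.
exists (absz ((u * i%:Z) %% q%:Z)%Z).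
  by rewrite -ltz_nat gez0_abs ?modz_ge0// ltz_mod.
rewrite -exprM !exprnP exprz_exp gez0_abs ?modz_ge0//.
have mE : (m %/ q)%:Z * q%:Z = m%:Z by rewrite -PoszM divnK.
apply/esym; set x := u * i%:Z.
apply: (@expz_zeta_mod R m m0 _ _ (v * i%:Z - e * (x %/ q%:Z)%Z)).
have -> : (x %% q%:Z)%Z = x - (x %/ q%:Z)%Z * q%:Z.
  by rewrite {2}(divz_eq x q%:Z) addrAC subrr add0r.
transitivity ((m %/ q)%:Z * i%:Z * (e * u) - e * (x %/ q%:Z)%Z * m%:Z).
  by move: (x %/ _)%Z => X; rewrite -mE /x; ring.
by rewrite eu -mE; ring.
Qed.

End SummandPoints.

(** * Intersections of Q with the origin and with the two summands *)

Section QSummands.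

Variables (R : realType) (a b m : nat) (c d : int).
Hypotheses (a0 : (0 < a)%N) (b0 : (0 < b)%N) (m0 : (0 < m)%N).
Hypothesis hcd : a%:Z * d - b%:Z * c = 1.

Lemma solution_memJ (I K : nat) : (a * I + b * K)%N = m ->
  c * I%:Z + d * K%:Z \in J a b m c d.
Proof.
move=> IK; apply/(memJ_solution m a0 b0 _ hcd); exists I, K; split=> //.
  have h : I%:Z * (a%:Z * d - b%:Z * c) = I%:Z by rewrite hcd mulr1.
  by rewrite -IK PoszD !PoszM; lia.
have h : K%:Z * (a%:Z * d - b%:Z * c) = K%:Z by rewrite hcd mulr1.
by rewrite -IK PoszD !PoszM; lia.
Qed.

Lemma memJ_nth (n : int) : n \in J a b m c d ->
  exists k : 'I_(size (J a b m c d)), (J a b m c d)`_k = n.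
Proof.
move=> nJ; have h := nJ; rewrite -index_mem in h.
by exists (Ordinal h); rewrite /= nth_index.
Qed.

Lemma summand_coord (t : {ffun 'I_m -> R}) (n n' : int) (w : C R) :
  xmap a b c d t = summand_incl a b m c d n w -> n' \in J a b m c d ->
  coord t n' = if n' == n then w else 0.
Proof.
by move=> e /memJ_nth[k <-]; rewrite -(@xmap_coord _ _ _ _ _ _ _ 0) e mxE.
Qed.

Hypothesis ell1 : (ell a b m <= 1)%N.

(** The simplex supplies some n in J whose coordinate is nonzero, and only n0 can have a nonzero
    coordinate in the summand. *)
Lemma Q_summand_value (t : {ffun 'I_m -> R}) (n0 : int) (w : C R) :
  @Sigma R a b m t -> xmap a b c d t = summand_incl a b m c d n0 w ->
  exists I K : nat, [/\ (a * I + b * K)%N = m, n0 = c * I%:Z + d * K%:Z &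
    w != 0 /\ ((I * K = 0)%N -> exists r : 'I_m, w = (zeta R m ^+ r) ^ n0)].
Proof.
move=> [F simF Ft] xt.
have [I [K [IK IK0 exc]]] := coord_simplex a0 b0 m0 hcd ell1 simF Ft.
set n := _ + _ in IK0 exc; have nJ : n \in J a b m c d by exact: solution_memJ.
(* In the exceptional case (I, K) = (b, a), the pairs (0, 2 a) and (2 b, 0) put n + 1 and n - 1 in
   J; both coordinates would be nonzero, but at most one of the two indices is n0. *)
have vanish : coord t n = 0 -> False.
  move=> /exc[Ib Ka].
  have n1J : n + 1 \in J a b m c d.
    have -> : n + 1 = c * 0%N%:Z + d * (K + a)%N%:Z.
      by rewrite /n Ib PoszD -hcd; ring.
    by apply: solution_memJ; rewrite -IK Ib; lia.
  have n2J : n - 1 \in J a b m c d.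
    have -> : n - 1 = c * (I + b)%N%:Z + d * 0%N%:Z.
      by rewrite /n Ka PoszD -hcd; ring.
    by apply: solution_memJ; rewrite -IK Ka; lia.
  rewrite (summand_coord xt n1J) (summand_coord xt n2J).
  case: (eqVneq (n + 1) n0) => [e1 _|_]; last by rewrite eqxx.
  by case: (eqVneq (n - 1) n0) => [e2|_]; [lia|rewrite eqxx].
exists I, K; move: vanish IK0; rewrite (summand_coord xt nJ).
case: (eqVneq n n0) => [en|//] vanish IK0; split=> //; split; first exact/eqP.
by rewrite -en.
Qed.

Lemma Q_not_origin : ~ @Q R a b m c d 0.
Proof.
move=> [t St xt].
(* The origin is the image of w = 0 for any index; 0 is an arbitrary choice. *)
have xt' : xmap a b c d t = summand_incl a b m c d 0 0.
  by rewrite xt; apply/rowP => k; rewrite !mxE if_same.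
by have [I [K [_ _ []]]] := Q_summand_value St xt'; rewrite eqxx.
Qed.

(** Common form of the second and third claims, with (q, e) = (a, c) or (b, d). A point of Q in the
    summand has the n0-th power of a vertex as coordinate, and q n0 = m e. Conversely, each root is
    reached by the barycentre of a residue class modulo q. *)
Lemma Q_summand_roots (q : nat) (e u v : int) : (0 < q)%N -> (q %| m)%N ->
  e * u = 1 + q%:Z * v ->
  (forall g, (q %| g)%N -> representable a b g) ->
  (forall n, n \in J a b m c d -> (m%:Z %| q%:Z * n)%Z ->
    n = e * (m %/ q)%:Z) ->
  (forall I K : nat, (a * I + b * K)%N = m ->
    c * I%:Z + d * K%:Z = e * (m %/ q)%:Z -> (I * K = 0)%N) ->
  @Q R a b m c d `&` @summand R a b m c d (e * (m %/ q)%:Z) =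
    @summand_roots R a b m c d (e * (m %/ q)%:Z) q.
Proof.
move=> q0 qm eu rep nuniq nIK; set n0 := e * _.
have mE : (m %/ q * q)%N = m by rewrite divnK.
have qn0 : q%:Z * n0 = m%:Z * e by rewrite /n0 -[in RHS]mE PoszM; ring.
apply/seteqP; split=> [y [[t St xt] [w _ wy]]|y [w /unity_rootP wq <-]].
  rewrite -wy in xt *; exists w => //=; apply/unity_rootP.
  have [I [K [IK n0E [_ hr]]]] := Q_summand_value St xt.
  have [|r ->] := hr; first by apply: nIK IK _; rewrite -n0E.
  rewrite !exprnP !exprz_exp; apply/eqP; rewrite expz_zeta_eq1//.
  by rewrite [n0 * _]mulrC qn0 mulrCA dvdz_mulr.
split; last by exists w.
have [r0 r0q wE] := root_of_unity_zeta m0 q0 qm eu wq.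
pose F : {set 'I_m} := [set r : 'I_m | (r %% q == r0)%N]%SET.
pose t : {ffun 'I_m -> R} := [ffun r => if r \in F then q%:R / m%:R else 0].
have sumF (V : nmodType) (f : nat -> V) :
    \sum_(r in F) f r = \sum_(k < m %/ q) f (r0 + q * k)%N.
  rewrite -(sum_residue (m %/ q) f r0q).
  rewrite -(big_mkord (fun r => r %% q == r0)%N) mE big_mkord.
  by apply: eq_bigl => r; rewrite inE.
have qm1 : (m %/ q)%:R * (q%:R / m%:R) = 1 :> R.
  by rewrite mulrA -natrM mE divff// pnatr_eq0 -lt0n.
exists t.
  exists F; last first.
    split; last by move=> r rF; rewrite ffunE (negbTE rF).
    split.
      by move=> r; rewrite ffunE; case: ifP => _ //; rewrite divr_ge0.
    under eq_bigr do rewrite ffunE.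
    rewrite -big_mkcond /= (sumF R (fun=> _)) sumr_const card_ord.
    by rewrite -[LHS]mulr_natl.
  apply: Sigma_simplex_intro.
    have r0m : (r0 < m)%N by apply: leq_trans r0q (dvdn_leq m0 qm).
    by apply/card_gt0P; exists (Ordinal r0m); rewrite inE /= modn_small.
  move=> r r'; rewrite !inE => /eqP rq /eqP r'q rr'.
  have d1 : (q %| r' - r)%N by rewrite -eqn_mod_dvd// rq r'q.
  split; apply: rep => //.
  have -> : (r + m - r' = m - (r' - r))%N by lia.
  by rewrite dvdn_sub.
apply/rowP => k; rewrite xmap_coord !mxE.
have kJ : (J a b m c d)`_k \in J a b m c d by rewrite mem_nth.
move: (_`_k) kJ => n nJ.
have -> : coord t n = ((q%:R / m%:R)%:C : C R) *
    \sum_(k0 < m %/ q) (zeta R m ^+ (r0 + q * k0)) ^ n.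
  rewrite mulr_sumr -(sumF (C R) (fun r => _ * (zeta R m ^+ r) ^ n)).
  rewrite [RHS]big_mkcond /=; apply: eq_bigr => r _; rewrite ffunE.
  by case: ifP => // _; rewrite mul0r.
have term k0 : (zeta R m ^+ (r0 + q * k0)) ^ n =
    (zeta R m ^+ r0) ^ n * (zeta R m ^ (q%:Z * n)) ^+ k0.
  rewrite exprD expfzMl !exprnP !exprz_exp PoszM; congr (_ * _ ^ _).
  by rewrite mulrAC.
under eq_bigr do rewrite term.
rewrite -mulr_sumr; case: (eqVneq n n0) => [->|nn0].
  have /eqP -> : zeta R m ^ (q%:Z * n0) == 1.
    by rewrite expz_zeta_eq1// qn0 dvdz_mulr.
  under eq_bigr do rewrite expr1n.
  rewrite sumr_const card_ord mulrCA mulr_natr -wE.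
  have -> : ((q%:R / m%:R)%:C : C R) *+ (m %/ q) = 1.
    by rewrite -(rmorphMn (real_complex R)) /= -[X in X%:C]mulr_natl qm1.
  by rewrite mulr1.
(* For n other than n0 the sum is geometric; its ratio zeta_m^(q n) differs from 1 by [nuniq]. *)
rewrite sum_powers_eq0 ?mulr0//.
  rewrite exprnP exprz_exp; apply/eqP; rewrite expz_zeta_eq1// mulrAC -PoszM.
  by rewrite mulnC mE dvdz_mulr.
by rewrite expz_zeta_eq1//; apply: contra_neqN nn0; exact: nuniq.
Qed.

End QSummands.

(** * The regular k-gon and the sectors of its edges *)

Lemma zetaM_expr (R : realType) (g k : nat) : (0 < g)%N ->
  zeta R (g * k) ^+ g = zeta R k.
Proof.
move=> g0; rewrite zeta_exp.
suff -> : 2 * pi / (g * k)%:R *+ g = 2 * pi / k%:R :> R by [].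
by rewrite -mulr_natr natrM invfM mulrA mulrAC divfK// pnatr_eq0 -lt0n.
Qed.

Section RegularPolygon.

Variables (R : realType) (k : nat).
Hypothesis k3 : (2 < k)%N.

(** A half step of the k-gon: odd powers of [h] point to the midpoints of edges, and [cs] is the
    apothem. *)
Let h : C R := zeta R (2 * k).
Let cs : R := cos (pi / k%:R).
Let sn : R := sin (pi / k%:R).

Let k0 : (0 < k)%N. Proof. exact: leq_trans k3. Qed.

Let hX e : h ^+ e = (cos (pi / k%:R *+ e) +i* sin (pi / k%:R *+ e) : C R).
Proof.
rewrite /h zeta_exp; suff -> : 2 * pi / (2 * k)%:R = pi / k%:R :> R by [].
by rewrite natrM invfM mulrACA divff ?mul1r// pnatr_eq0.
Qed.

Let hE : h = (cs +i* sn : C R).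
Proof. by rewrite -[h]expr1 hX mulr1n. Qed.

Let h2k : h ^+ (2 * k) = 1.
Proof. by apply: (prim_expr_order (zeta_prim R _)); rewrite muln_gt0. Qed.

Let cs2 : cs ^+ 2 + sn ^+ 2 = 1. Proof. exact: cos2Dsin2. Qed.

Let pi_k : pi / k%:R *+ k = pi :> R.
Proof. by rewrite -[LHS]mulr_natr divfK// pnatr_eq0 -lt0n. Qed.

Let angle_gt0 : 0 < pi / k%:R :> R.
Proof. by rewrite divr_gt0 ?pi_gt0 ?ltr0n. Qed.

Lemma Re_half_gt0 : 0 < complex.Re (zeta R (2 * k)).
Proof.
rewrite -/h hE /=; apply: cos_gt0_pihalf; apply/andP; split.
  by apply: lt_trans angle_gt0; rewrite oppr_lt0 divr_gt0 ?pi_gt0.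
by rewrite ltr_pM2l ?pi_gt0// ltf_pV2 ?posrE ?ltr0n// ltr_nat.
Qed.

Let sn0 : 0 < sn.
Proof.
apply: sin_gt0_pi; rewrite angle_gt0/= gtr_pMr ?pi_gt0//.
by rewrite invf_lt1 ?ltr0n// ltr1n (leq_trans _ k3).
Qed.

(** An odd multiple of pi / k stays at least pi / k away from all multiples of 2 pi; after
    reflecting it into [0, pi], the cosine is decreasing. *)
Lemma Re_half_max e : odd e ->
  complex.Re (zeta R (2 * k) ^+ e) <= complex.Re (zeta R (2 * k)).
Proof.
rewrite -/h => odd_e; rewrite -(expr_mod _ h2k) hX hE /=.
have lt2k : (e %% (2 * k) < 2 * k)%N by rewrite ltn_mod muln_gt0.
have {odd_e} : odd (e %% (2 * k)).
  by move: odd_e; rewrite {1}(divn_eq e (2 * k)) oddD !oddM /= andbF.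
move: (e %% _)%N lt2k => {}e lt2k odd_e.
have e0 : (0 < e)%N by case: (e) odd_e.
have cos_le f : (0 < f <= k)%N -> cos (pi / k%:R *+ f) <= cos (pi / k%:R) :> R.
  move=> /andP[f0 fk].
  have angle_le i j : (i <= j)%N -> pi / k%:R *+ i <= pi / k%:R *+ j :> R.
    by move=> ij; rewrite ler_pMn2l.
  have itv i : (i <= k)%N -> pi / k%:R *+ i \in `[0, pi : R].
    by move=> ik; rewrite in_itv /= (angle_le 0%N i)// -[leRHS]pi_k angle_le.
  move: f0; rewrite leq_eqVlt => /predU1P[<-|f1]; first by rewrite mulr1n.
  apply: ltW; rewrite -[X in _ < cos X]mulr1n ltr_cos ?itv//.
  by rewrite ltr_pMn2l.
case: (leqP e k) => [ek|ke]; first by rewrite cos_le ?e0.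
have -> : cos (pi / k%:R *+ e) = cos (pi / k%:R *+ (2 * k - e)) :> R.
  rewrite -[LHS]cosN -[LHS]cosD2pi; congr cos.
  rewrite mulrnBr ?(ltnW lt2k)// addrC; congr (_ - _).
  by rewrite mulnC mulrnA pi_k.
by apply: cos_le; lia.
Qed.

(* The functional Re (p h^(2s+1)), with h^2 = zeta_k, is maximal for the edge
   facing p; comparing it with its values for the two adjacent edges shows that
   the coordinates of p in the end points of that edge are nonnegative. *)
Lemma polygon_sector (p : C R) : exists (s : 'I_k) (u v : R),
  [/\ 0 <= u, 0 <= v,
    p = (u%:C : C R) * zeta R k ^+ (k - s) +
        (v%:C : C R) * zeta R k ^+ (k - s).-1,
    (u + v) * complex.Re (zeta R (2 * k)) =
      complex.Re (p * zeta R (2 * k) ^+ (2 * s).+1) &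
    forall s', complex.Re (p * zeta R (2 * k) ^+ (2 * s').+1) <=
      (u + v) * complex.Re (zeta R (2 * k))].
Proof.
rewrite -/h; have [s s_max'] : exists s : 'I_k, forall s' : 'I_k,
    complex.Re (p * h ^+ (2 * s').+1) <= complex.Re (p * h ^+ (2 * s).+1).
  case: (@Order.TotalTheory.arg_maxP _ _ _ (Ordinal k0) xpredT
    (fun s : 'I_k => complex.Re (p * h ^+ (2 * s).+1))) => // s _ hs.
  by exists s => s'; apply: hs.
have s_max s' : complex.Re (p * h ^+ (2 * s').+1) <=
    complex.Re (p * h ^+ (2 * s).+1).
  have -> : h ^+ (2 * s').+1 = h ^+ (2 * (s' %% k)).+1.
    rewrite !exprS {1}(divn_eq s' k) mulnDr exprD mulnCA mulnC exprM h2k.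
    by rewrite expr1n mul1r.
  exact: (s_max' (Ordinal (ltn_pmod s' k0))).
have wE j : zeta R k ^+ j = h ^+ (2 * j).
  by rewrite exprM /h zetaM_expr.
set p' := p * h ^+ (2 * s).
have pE : p = p' * h ^+ (2 * (k - s)).
  rewrite /p' -mulrA -exprD -mulnDr subnKC ?h2k ?mulr1//; exact: ltnW.
have L0 : complex.Re (p * h ^+ (2 * s).+1) = complex.Re (p' * h).
  by rewrite exprSr mulrA.
have L1 : complex.Re (p' * h ^+ 3) <= complex.Re (p' * h).
  rewrite -L0 /p' -mulrA -exprD; have := s_max s.+1.
  by have -> : (2 * s.+1).+1 = (2 * s + 3)%N by lia.
have hV : h ^+ (2 * k).-1 = (cs -i* sn : C R).
  have h_neq0 : h != 0 by apply: zeta_neq0; rewrite muln_gt0.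
  apply: (mulIf h_neq0); rewrite -exprSr prednK ?muln_gt0// h2k hE.
  apply/eqP; rewrite eq_complex /=; apply/andP; split; apply/eqP.
    by rewrite -cs2; ring.
  by ring.
(* The preceding edge: k - 1 stands for -1, as h^(2k) = 1. *)
have L2 : complex.Re (p' * h ^+ (2 * k).-1) <= complex.Re (p' * h).
  rewrite -L0 /p' -mulrA -exprD; have := s_max (s + k.-1)%N.
  by have -> : (2 * (s + k.-1)).+1 = (2 * s + (2 * k).-1)%N by lia.
have h3 : h ^+ 3 = ((cs ^+ 3 - 3 * cs * sn ^+ 2) +i*
    (3 * cs ^+ 2 * sn - sn ^+ 3) : C R).
  by rewrite hE !exprS expr0 mulr1; apply/eqP; rewrite eq_complex /=;
    apply/andP; split; apply/eqP; ring.
have cs0 : 0 < cs by have := Re_half_gt0; rewrite -/h hE.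
have ReE x y : complex.Re ((x +i* y : C R) * h) = x * cs - y * sn by rewrite hE.
have Reh : complex.Re h = cs by rewrite hE.
move: L0 L1 L2; rewrite hV h3; case: (p') pE => x y pE; rewrite ReE => L0.
move=> L1' L2'.
have L1 : x * (cs ^+ 3 - 3 * cs * sn ^+ 2) - y * (3 * cs ^+ 2 * sn - sn ^+ 3) <=
    x * cs - y * sn := L1'.
have L2 : x * cs - y * - sn <= x * cs - y * sn := L2'.
(* Solution of p' = u + v h^(-2), where h^(-2) = cs^2 - sn^2 - 2 cs sn i. *)
pose v := - y / (2 * cs * sn); pose u := x - v * (cs ^+ 2 - sn ^+ 2).
have yE : y = - (2 * cs * sn * v).
  by rewrite /v mulrC divfK ?opprK// !mulf_neq0 ?pnatr_eq0 ?gt_eqF.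
have xE : x = u + v * (cs ^+ 2 - sn ^+ 2) by rewrite /u subrK.
have e0 : x * cs - y * sn = (u + v) * cs.
  transitivity (u * cs + v * cs * (cs ^+ 2 + sn ^+ 2)).
    by rewrite xE yE; ring.
  by rewrite cs2; ring.
exists s, u, v; rewrite Reh; split=> //.
- have e3 : x * (cs ^+ 3 - 3 * cs * sn ^+ 2) -
      y * (3 * cs ^+ 2 * sn - sn ^+ 3) =
      (u + v) * cs - 4 * sn ^+ 2 * cs * u.
    transitivity (u * (cs * (cs ^+ 2 + sn ^+ 2) - 4 * cs * sn ^+ 2) +
      v * cs * (cs ^+ 2 + sn ^+ 2) ^+ 2); first by rewrite xE yE; ring.
    by rewrite cs2; ring.
  move: L1; rewrite e3 e0 gerDl oppr_le0 pmulr_rge0//.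
  by rewrite !mulr_gt0// exprn_gt0.
- have : 0 <= 4 * sn ^+ 2 * cs * v by move: L2; rewrite yE; lra.
  by rewrite pmulr_rge0// !mulr_gt0// exprn_gt0.
- have [j jE] : exists j, (k - s)%N = j.+1.
    by exists (k - s).-1; rewrite prednK// subn_gt0.
  have sq : (x +i* y : C R) * h ^+ 2 = (u%:C : C R) * h ^+ 2 + (v%:C : C R).
    rewrite hE expr2; apply/eqP; rewrite eq_complex /=.
    apply/andP; split; apply/eqP.
      transitivity (u * (cs ^+ 2 - sn ^+ 2) + v * (cs ^+ 2 + sn ^+ 2) ^+ 2).
        by rewrite xE yE; ring.
      by rewrite cs2; ring.
    by rewrite xE yE; ring.
  by rewrite pE !wE jE /= mulnS exprD [LHS]mulrA sq mulrDl -mulrA.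
- by rewrite -e0 -L0.
by move=> s'; rewrite -e0 -L0.
Qed.

End RegularPolygon.

(** * Estimates and two-vertex simplices *)

Lemma norm_zetaX (R : realType) (k e : nat) : `|zeta R k ^+ e| = 1.
Proof.
rewrite normrX; suff -> : `|zeta R k| = 1 by rewrite expr1n.
by rewrite [LHS]normc_def /= cos2Dsin2 sqrtr1.
Qed.

Lemma Re_le_norm (R : realType) (x : C R) (e : R) :
  `|x| < (e%:C : C R) -> complex.Re x < e.
Proof.
move=> xe; rewrite -ltcR; apply: le_lt_trans xe.
by apply: le_trans (normc_ge_Re x); rewrite lecR ler_norm.
Qed.

Lemma coord_segment (R : realType) (m : nat) (n : int) (r r' : 'I_m)
    (u v e : R) :
  coord [ffun i => u * (i == r')%:R + v * (i == r)%:R + e] n =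
    (u%:C : C R) * (zeta R m ^+ r') ^ n + (v%:C : C R) * (zeta R m ^+ r) ^ n +
    (e%:C : C R) * \sum_(i < m) (zeta R m ^+ i) ^ n.
Proof.
have pick (w : R) (i0 : 'I_m) (f : 'I_m -> C R) :
    \sum_i ((w * (i == i0)%:R)%:C : C R) * f i = (w%:C : C R) * f i0.
  rewrite (bigD1 i0)//= eqxx mulr1 big1 ?addr0// => i /negbTE ->.
  by rewrite mulr0 mul0r.
rewrite /coord -(pick u r' (fun i => (zeta R m ^+ i) ^ n)).
rewrite -(pick v r (fun i => (zeta R m ^+ i) ^ n)) mulr_sumr -!big_split.
apply: eq_bigr => i _; rewrite ffunE !(rmorphD (real_complex R)).
by rewrite mulrDl mulrDl.
Qed.

Lemma sum_segment (R : realType) (m : nat) (r r' : 'I_m) (u v e : R) :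
  \sum_i [ffun i : 'I_m => u * (i == r')%:R + v * (i == r)%:R + e] i =
    u + v + e *+ m.
Proof.
have pick (w : R) (i0 : 'I_m) : \sum_(i < m) w * (i == i0)%:R = w.
  rewrite (bigD1 i0)//= eqxx mulr1 big1 ?addr0// => i /negbTE ->.
  by rewrite mulr0.
under eq_bigr do rewrite ffunE.
by rewrite !big_split /= !pick sumr_const card_ord.
Qed.

(** The gaps are delta and m - delta, in an order that depends on whether r + delta passes m; if r =
    r', the only gap is m, the sum of both. *)
Lemma pair_simplex (a b m delta : nat) (r r' : 'I_m) :
  representable a b delta -> representable a b (m - delta) ->
  (delta <= m)%N -> r' = ((r + delta) %% m)%N :> nat ->
  Sigma_simplex a b [set r; r']%SET.
Proof.
move=> [i1 [j1 e1]] [i2 [j2 e2]] dm r'E.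
have rep0 : representable a b 0 by exists 0%N, 0%N; rewrite !muln0.
have repm : representable a b m.
  by exists (i1 + i2)%N, (j1 + j2)%N; rewrite !mulnDr; lia.
have repd : representable a b delta by exists i1, j1.
have repd' : representable a b (m - delta) by exists i2, j2.
have cases : r' = (r + delta)%N :> nat \/ (r' + (m - delta))%N = r.
  move: r'E; case: (ltnP (r + delta) m) => [lt|ge].
    by rewrite modn_small// => ->; left.
  rewrite -{1}(subnK ge) modnDr modn_small; last by have := ltn_ord r; lia.
  by move=> ->; right; lia.
apply: Sigma_simplex_intro; first by rewrite cards2.
have lt := ltn_ord r; have lt' := ltn_ord r'.
have conv x y : x = y -> representable a b x -> representable a b y by move=> ->.
move=> x y; rewrite !inE => /orP[]/eqP-> /orP[]/eqP-> le.
- by split; [apply: conv rep0|apply: conv repm]; lia.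
- case: cases => e; first by split; [apply: conv repd|apply: conv repd']; lia.
  have e' : r = r' :> nat by lia.
  by split; [apply: conv rep0|apply: conv repm]; lia.
- case: cases => e; last by split; [apply: conv repd'|apply: conv repd]; lia.
  have e' : r = r' :> nat by lia.
  by split; [apply: conv rep0|apply: conv repm]; lia.
- by split; [apply: conv rep0|apply: conv repm]; lia.
Qed.

(** * The boundary of P when J is a single integer *)

Section Boundary.

Variables (R : realType) (a b m : nat) (c d : int) (I K : nat).
Hypotheses (a1 : (1 < a)%N) (b0 : (0 < b)%N) (m0 : (0 < m)%N).
Hypothesis hcd : a%:Z * d - b%:Z * c = 1.
Hypotheses (I0 : (0 < I)%N) (K0 : (0 < K)%N) (IK : (a * I + b * K)%N = m).
Let n : int := c * I%:Z + d * K%:Z.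
Hypothesis Jn : forall n', n' \in J a b m c d -> n' = n.
Local Notation z := (zeta R m).
Let g := gcdn I K.
Let k := (m %/ g)%N.
Let h := zeta R (2 * k).

Let a0 : (0 < a)%N. Proof. exact: ltnW. Qed.

Let g0 : (0 < g)%N. Proof. by rewrite gcdn_gt0 I0. Qed.

Let mE : m = (g * k)%N.
Proof.
by rewrite mulnC divnK// -IK dvdn_add// dvdn_mull ?dvdn_gcdl ?dvdn_gcdr.
Qed.

(** k = a (I/g) + b (K/g), where both quotients are positive and a > 1. *)
Let k3 : (2 < k)%N.
Proof.
have /dvdnP[i Ii] : (g %| I)%N by exact: dvdn_gcdl.
have /dvdnP[j Kj] : (g %| K)%N by exact: dvdn_gcdr.
have kE : k = (a * i + b * j)%N.
  apply/eqP; rewrite -(eqn_pmul2l g0) -mE -{1}IK Ii Kj; apply/eqP; ring.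
have i0 : (0 < i)%N by case: (i) Ii I0 => // ->; rewrite mul0n.
have j0 : (0 < j)%N by case: (j) Kj K0 => // ->; rewrite mul0n.
by rewrite kE; nia.
Qed.

Let k0 : (0 < k)%N. Proof. exact: leq_trans k3. Qed.

Let zg : z ^+ g = zeta R k.
Proof. by rewrite {1}mE zetaM_expr. Qed.

(** Since g divides I and K it divides n, and zeta_m^g = zeta_k. *)
Lemma vertex_polygon (r : nat) : exists j, (z ^+ r) ^ n = zeta R k ^+ j.
Proof.
have /dvdnP[i Ii] : (g %| I)%N by exact: dvdn_gcdl.
have /dvdnP[j Kj] : (g %| K)%N by exact: dvdn_gcdr.
pose n' := c * i%:Z + d * j%:Z.
exists (absz ((r%:Z * n') %% k%:Z)%Z).
rewrite !exprnP exprz_exp gez0_abs ?modz_ge0//; last by rewrite gt_eqF.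
have -> : r%:Z * n = g%:Z * (r%:Z * n') by rewrite /n /n' Ii Kj !PoszM; ring.
rewrite -exprz_exp -exprnP zg.
apply: (@expz_zeta_mod R k k0 _ _ ((r%:Z * n') %/ k%:Z)%Z).
by rewrite {1}(divz_eq (r%:Z * n') k%:Z) addrC [X in _ + X]mulrC.
Qed.

(** With A K = B I + g, a move by delta = a A + b B changes the exponent of the n-th coordinate by K
    A - I B = g modulo m, one step of the k-gon. As A <= I and B <= K, the complementary gap m -
    delta is representable too. *)
Lemma edge_simplex (j : nat) : exists r r' : 'I_m,
  [/\ (z ^+ r) ^ n = zeta R k ^+ j, (z ^+ r') ^ n = zeta R k ^+ j.+1 &
    Sigma_simplex a b [set r; r']%SET].
Proof.
case: (egcdnP I K0) => A B; rewrite gcdnC -/g => AB Bg.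
have BK : (B < K)%N by apply: leq_ltn_trans Bg; rewrite leq_pmulr.
have gI : (g <= I)%N by apply: dvdn_leq (dvdn_gcdl I K).
have AI : (A <= I)%N.
  rewrite -(leq_pmul2r K0) AB.
  have : (B.+1 * I <= K * I)%N by rewrite leq_mul2r BK orbT.
  by rewrite mulSn; lia.
pose delta := (a * A + b * B)%N.
have dm : (delta <= m)%N by rewrite -IK leq_add// leq_mul2l ?AI ?(ltnW BK) orbT.
have zd i : (z ^+ ((i * delta) %% m)) ^ n = zeta R k ^+ i.
  rewrite (expr_mod _ (prim_expr_order (zeta_prim R m0))) -zg -exprM.
  rewrite !exprnP exprz_exp.
  apply: (@expz_zeta_mod R m m0 _ _ (i%:Z * (c * A%:Z + d * B%:Z))).
  have ABZ : A%:Z * K%:Z = B%:Z * I%:Z + g%:Z by rewrite -!PoszM -PoszD AB.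
  have hK : K%:Z * (a%:Z * d - b%:Z * c) = K%:Z by rewrite hcd mulr1.
  have hI : I%:Z * (a%:Z * d - b%:Z * c) = I%:Z by rewrite hcd mulr1.
  have gE : g%:Z = A%:Z * (K%:Z * (a%:Z * d - b%:Z * c)) -
      B%:Z * (I%:Z * (a%:Z * d - b%:Z * c)) by rewrite hK hI ABZ; ring.
  by rewrite PoszM [(g * i)%N%:Z]PoszM gE -IK /delta /n !PoszD !PoszM; ring.
exists (Ordinal (ltn_pmod (j * delta) m0)).
exists (Ordinal (ltn_pmod (j.+1 * delta) m0)).
split; [exact: zd|exact: zd|].
apply: (@pair_simplex _ _ _ delta) => //.
- by exists A, B.
- exists (I - A)%N, (K - B)%N; rewrite -IK /delta !mulnBr.
  have q1 : (a * A <= a * I)%N by rewrite leq_mul2l AI orbT.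
  have q2 : (b * B <= b * K)%N by rewrite leq_mul2l (ltnW BK) orbT.
  by lia.
by rewrite /= modnDml mulSn addnC.
Qed.

Let sum0 : \sum_(i < m) (z ^+ i) ^ n = 0.
Proof.
under eq_bigr do rewrite exprnP exprzAC -exprnP.
apply: sum_powers_eq0.
  by rewrite exprnP exprzAC -exprnP (prim_expr_order (zeta_prim R m0)) exp1rz.
(* Were zeta_m^n = 1, the vertex with n-th coordinate zeta_k would give zeta_k = 1. *)
apply/eqP => zn1; have [r [r' [_ zr' _]]] := edge_simplex 0.
have /eqP : zeta R k ^+ 1 = 1.
  by rewrite -zr' exprnP exprzAC zn1 -exprnP expr1n.
by rewrite -(prim_order_dvd (zeta_prim R k0)) dvdn1 gtn_eqF// ltnW.
Qed.

Lemma functional_le (t : {ffun 'I_m -> R}) (s : nat) : @Delta R m t ->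
  complex.Re (coord t n * h ^+ (2 * s).+1) <= complex.Re h.
Proof.
move=> [t0 t1]; rewrite mulr_suml.
under eq_bigr do rewrite -mulrA.
rewrite Re_wsum -[leRHS]mul1r -t1 mulr_suml; apply: ler_sum => r _.
apply: ler_wpM2l => //; have [j ->] := vertex_polygon r.
rewrite -[zeta R k](@zetaM_expr R 2)// -exprM -exprD.
by apply: Re_half_max => //; rewrite addnS /= -mulnDr oddM.
Qed.

(** The missing weight 1 - u - v is spread evenly over all vertices, where it contributes 0 to the
    coordinate; for u + v = 1 only the edge remains. *)
Lemma segment_Delta (j : nat) (u v : R) : 0 <= u -> 0 <= v -> u + v <= 1 ->
  exists2 t, @Delta R m t & coord t n =
    (u%:C : C R) * zeta R k ^+ j.+1 + (v%:C : C R) * zeta R k ^+ j /\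
    (u + v = 1 -> @Sigma R a b m t).
Proof.
move=> u0 v0 uv1; have [r [r' [zr zr' simF]]] := edge_simplex j.
set e := (1 - (u + v)) / m%:R.
have tD : @Delta R m [ffun i => u * (i == r')%:R + v * (i == r)%:R + e].
  split=> [i|].
    by rewrite ffunE !addr_ge0 ?mulr_ge0 ?invr_ge0 ?subr_ge0.
  by rewrite sum_segment -mulr_natr divfK ?subrKC// pnatr_eq0 -lt0n.
eexists; first exact: tD.
split; first by rewrite coord_segment sum0 mulr0 addr0 zr zr'.
move=> uv; exists [set r; r']%SET => //; split=> // i.
rewrite !inE negb_or ffunE => /andP[/negbTE -> /negbTE ->].
by rewrite /e uv subrr mul0r !mulr0 !addr0.
Qed.

(** The sum u + v of the sector coordinates acts as the gauge of the k-gon: below 1 the point is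
    interior, above 1 a functional separates it from P, and at 1 it lies on an edge. *)
Lemma boundary_polytope_sub_Q :
  boundary (@polytope R a b m c d) `<=` @Q R a b m c d.
Proof.
have nJ : n \in J a b m c d by exact: solution_memJ.
have [k1 k1n] := memJ_nth nJ.
have row_ext (y y' : lambdabar R a b m c d) : y 0 k1 = y' 0 k1 -> y = y'.
  move=> e; apply/rowP => k2; suff -> : k2 = k1 by [].
  apply/val_inj/eqP; rewrite -(nth_uniq 0 _ _ (uniq_J a b m c d)) ?ltn_ord//.
  by rewrite k1n (Jn (mem_nth 0 (ltn_ord k2))).
have xmapE t : xmap a b c d t 0 k1 = coord t n by rewrite xmap_coord k1n.
have c0 : 0 < complex.Re h := Re_half_gt0 R k3.
have close (p p' : C R) (e : R) (s : nat) : `|p - p'| < (e%:C : C R) ->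
    complex.Re (p * h ^+ (2 * s).+1) < complex.Re (p' * h ^+ (2 * s).+1) + e.
  move=> pp'; rewrite -ltrBlDl.
  have -> : complex.Re (p * h ^+ (2 * s).+1) - complex.Re (p' * h ^+ (2 * s).+1)
      = complex.Re ((p - p') * h ^+ (2 * s).+1).
    by rewrite mulrBl; case: (p * _) => ? ?; case: (p' * _).
  by apply: Re_le_norm; rewrite normrM norm_zetaX mulr1.
move=> y [ycl yint]; pose p : C R := y 0 k1.
have [s [u [v [u0 v0 pE Ls Lle]]]] := polygon_sector k3 p.
rewrite -/h in Ls Lle.
have edgeE (s1 : 'I_k) : (k - s1 = (k - s1).-1.+1)%N.
  by rewrite prednK// subn_gt0.
case: (ltgtP (u + v) 1) => uv.
- exfalso; apply: yint.
  (* The slack of the largest functional at p; each functional grows by less than [e] within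
     distance [e], so nearby points still have gauge at most 1. *)
  pose e := (1 - (u + v)) * complex.Re h.
  have e0 : 0 < e by rewrite mulr_gt0// subr_gt0.
  apply/nbhs_ballP; exists (e%:C : C R); first by rewrite /= ltcR.
  move=> q [_ /(_ 0 k1) yq].
  have {}yq : `|p - q 0 k1| < (e%:C : C R) by exact: yq.
  have [s1 [u1 [v1 [u10 v10 qE Ls1 _]]]] := polygon_sector k3 (q 0 k1).
  have uv1 : u1 + v1 <= 1.
    rewrite -(ler_pM2r c0) mul1r [leLHS]Ls1 -/h.
    rewrite distrC in yq; apply: ltW; apply: lt_le_trans (close _ _ _ s1 yq) _.
    by rewrite -lerBrDr; apply: le_trans (Lle s1) _; rewrite /e; lra.
  have [t tD [tE _]] := segment_Delta (k - s1).-1 u10 v10 uv1.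
  by exists t => //; apply: row_ext; rewrite xmapE tE qE -edgeE.
(* A point of P closer than this excess would still exceed the apothem, against [functional_le]. *)
- exfalso; pose e := ((u + v) - 1) * complex.Re h.
  have e0 : 0 < e by rewrite mulr_gt0// subr_gt0.
  have [|q [[t tD <-] yq]] := ycl (ball y (e%:C : C R)).
    by apply: nbhsx_ballx; rewrite ltcR.
  case: yq => _ /(_ 0 k1) yq.
  have {}yq : `|p - xmap a b c d t 0 k1| < (e%:C : C R) by exact: yq.
  have := close _ _ _ s yq; rewrite -Ls xmapE.
  by have := functional_le s tD; rewrite /e; lra.
have [|t tD [tE tS]] := @segment_Delta (k - s).-1 u v u0 v0; first by rewrite uv.
by exists t; [exact: tS|apply: row_ext; rewrite xmapE tE -edgeE -pE].
Qed.

End Boundary.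

(** * Assembly of the four claims *)

Lemma small_multiple_eq0 (m q x : nat) (s : int) : (0 < m)%N -> (1 < q)%N ->
  (q * x <= m)%N -> x%:Z = m%:Z * s -> s = 0.
Proof.
move=> m0 q1 qx xE; case: s xE => [[//|s]|s] xE; last by nia.
have : (m * s.+1 <= x)%N by rewrite -lez_nat PoszM -xE.
by rewrite mulnS; nia.
Qed.

Theorem proposition6p3 (R : realType) (a b m : nat) (c d : int)
    (ha : (1 < a)%N) (hab : (a < b)%N) (hcop : coprime a b) (hm : (0 < m)%N)
    (hcd : a%:Z * d - b%:Z * c = 1) (hell : (ell a b m <= 1)%N) :
  [/\ ~ @Q R a b m c d 0,
      (a %| m)%N ->
        @Q R a b m c d `&` @summand R a b m c d (c * (m %/ a)%:Z)
        = @summand_roots R a b m c d (c * (m %/ a)%:Z) a,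
      (b %| m)%N ->
        @Q R a b m c d `&` @summand R a b m c d (d * (m %/ b)%:Z)
        = @summand_roots R a b m c d (d * (m %/ b)%:Z) b
    & ~~ (a %| m)%N -> ~~ (b %| m)%N ->
        boundary (@polytope R a b m c d) `<=` @Q R a b m c d].
Proof.
have a0 : (0 < a)%N by exact: ltnW.
have b1 : (1 < b)%N by exact: ltn_trans hab.
have b0 : (0 < b)%N by exact: ltnW.
have scaled (i : nat) : i%:Z * (a%:Z * d - b%:Z * c) = i%:Z.
  by rewrite hcd mulr1.
split.
- exact: Q_not_origin.
(* Modulo a, the inverse of c is -b. *)
- move=> am; apply: (@Q_summand_roots R a b m c d a0 b0 hm hcd hell
    a c (- b%:Z) (- d)) => //.
  + by rewrite -hcd; ring.
  + by move=> g /dvdnP[k ->]; exists k, 0%N; rewrite muln0 addn0 mulnC.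
  (* If m divides a n, then m divides K = a n - c m, and b K <= m leaves only K = 0. *)
  + move=> n /(memJ_solution m a0 b0 n hcd)[I [K [IK _ _ KE]]] /dvdzP[s sE].
    have /eqP : s - c = 0.
      apply: (@small_multiple_eq0 m b K) => //; first by rewrite -IK leq_addl.
      by rewrite KE sE; ring.
    rewrite subr_eq0 => /eqP sc; apply: (@mulfI _ a%:Z); first by rewrite gt_eqF.
    by rewrite sE sc mulrCA -PoszM [(a * _)%N]mulnC divnK.
  move=> I K IK e; have : K%:Z = 0; last by case=> ->; rewrite muln0.
  have h1 : a%:Z * (c * I%:Z + d * K%:Z) = c * m%:Z.
    by rewrite e mulrCA -PoszM mulnC divnK.
  have h2 := scaled K; rewrite -IK PoszD !PoszM in h1; lia.
(* Modulo b, the inverse of d is a. *)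
- move=> bm; apply: (@Q_summand_roots R a b m c d a0 b0 hm hcd hell
    b d a%:Z c) => //.
  + by rewrite -hcd; ring.
  + by move=> g /dvdnP[k ->]; exists 0%N, k; rewrite muln0 add0n mulnC.
  + move=> n /(memJ_solution m a0 b0 n hcd)[I [K [IK _ IE _]]] /dvdzP[s sE].
    have /eqP : d - s = 0.
      apply: (@small_multiple_eq0 m a I) => //; first by rewrite -IK leq_addr.
      by rewrite IE sE; ring.
    rewrite subr_eq0 => /eqP sd; apply: (@mulfI _ b%:Z); first by rewrite gt_eqF.
    by rewrite sE -sd mulrCA -PoszM [(b * _)%N]mulnC divnK.
  move=> I K IK e; have : I%:Z = 0; last by case=> ->.
  have h1 : b%:Z * (c * I%:Z + d * K%:Z) = d * m%:Z.
    by rewrite e mulrCA -PoszM mulnC divnK.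
  have h2 := scaled I; rewrite -IK PoszD !PoszM in h1; lia.
move=> am bm.
have pos I K : (a * I + b * K)%N = m -> (0 < I)%N /\ (0 < K)%N.
  move=> IK; split.
    by case: (posnP I) IK bm => // -> <-; rewrite muln0 add0n dvdn_mulr.
  by case: (posnP K) IK am => // -> <-; rewrite muln0 addn0 dvdn_mulr.
case: (pselect (exists n, n \in J a b m c d)) => [[n nJ]|noJ]; last first.
  (* For empty J the ambient space is a single point, and P is all of it, so the boundary is
     empty. *)
  move=> y [ycl yint]; exfalso; apply: yint.
  have row_eq (y1 y2 : lambdabar R a b m c d) : y1 = y2.
    by apply/rowP => k; case: noJ; exists (J a b m c d)`_k; rewrite mem_nth.
  have [q [Pq _]] := ycl setT filterT.
  have -> : @polytope R a b m c d = setT.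
    by apply/seteqP; split=> // x _; rewrite (row_eq x q).
  by rewrite interiorT.
have [I [K [IK nE _ _]]] := (memJ_solution m a0 b0 n hcd).1 nJ.
have [I0 K0] := pos I K IK.
(* All pairs behind elements of J are positive here, so [hell] leaves only one element. *)
apply: (@boundary_polytope_sub_Q R a b m c d I K) => // n' n'J.
have [I' [K' [IK' -> _ _]]] := (memJ_solution m a0 b0 n' hcd).1 n'J.
have [I'0 K'0] := pos I' K' IK'.
by have [-> ->] := ell_le1_uniq a0 b0 hell I0 K0 I'0 K'0 IK IK'.
Qed.
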